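(* Let $\sigma:\mathbb N\to\mathbb N$ be defined by $\sigma(i)=i+1$. There exists a $\sigma$-finite measure $\mu$ on $(\mathbb N,2^{\mathbb N})$ such that $\sigma$ is one-to-one and bimeasurable, and, for every $1\le p<\infty$, the composition operator $T_\sigma:\varphi\mapsto\varphi\circ\sigma$ on $L^p(\mathbb N,2^{\mathbb N},\mu)$ is a bounded linear operator that is topologically transitive but not topologically mixing. Moreover, $\sigma$ does not satisfy the following condition: for each $\epsilon>0$, there exist a measurable set $B\subset\mathbb N$ and an integer $k\ge1$ such that $\mu(\mathbb N\setminus B)<\epsilon$ and $B\cap\sigma^k(B)=\emptyset$.
   Context: $\mathbb N=\{1,2,3,\ldots\}$ and $2^{\mathbb N}$ is the $\sigma$-algebra of all subsets of $\mathbb N$. A map is bimeasurable if both preimages and images of measurable sets are measurable. A bounded linear operator $T$ on a Banach space $\mathcal X$ is topologically transitive if for any nonempty open sets $U,V\subset\mathcal X$ there exists an integer $k\ge0$ with $T^k(U)\cap V\ne\emptyset$; it is topologically mixing if for any such $U,V$ there exists $k_0\ge0$ with $T^k(U)\cap V\neq\emptyset$ for every $k\ge k_0$. *)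

(* Defs.v *)
From HB Require Import structures.
From mathcomp Require Import all_boot all_order all_algebra.
From mathcomp Require Import all_classical all_reals all_analysis.
From mathcomp Require Import generic_quotient ess_sup_inf measurable_realfun.
Set Implicit Arguments.
Unset Strict Implicit.
Unset Printing Implicit Defensive.
Import Order.TTheory GRing.Theory Num.Theory.
Import numFieldNormedType.Exports.
Local Open Scope classical_set_scope.
Local Open Scope ring_scope.
Local Open Scope quotient_scope.

(* hoelder.v provides the type [LspaceType mu p1] of classes of p-integrable
   functions modulo equality mu-a.e., but no algebraic or topological structure
   on it. This section makes it a normed module over R for the Lp-norm; as
   usual, vector operations are computed on representatives. *)
Section Lspace_normed.
Context d (T : measurableType d) (R : realType).
Variables (mu : {measure set T -> \bar R}) (p : \bar R) (p1 : (1 <= p)%E).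

Local Notation Lp := (LspaceType mu p1).
Local Notation Lf := (LfunType mu p1).
Local Notation M := {mfun_ mu, T >-> measurableTypeR R}.

Lemma ae_eq_Lnorm (f g : {mfun T >-> R}) : f = g %[ae mu] ->
  ('N[mu]_p[EFin \o f] = 'N[mu]_p[EFin \o g])%E.
Proof.
move=> fg; rewrite unlock /Lnorm; case: p p1 => [r r1|_|//].
- congr (_ `^ _)%E; apply: ae_eq_integral => //=.
  + apply/measurable_EFinP.
    apply: (@measurableT_comp _ _ _ _ _ _ (@powR R ^~ r)) => //.
    exact: measurableT_comp.
  + apply/measurable_EFinP.
    apply: (@measurableT_comp _ _ _ _ _ _ (@powR R ^~ r)) => //.
    exact: measurableT_comp.
  + by apply: filterS fg => x /= h /h ->.
- case: ifPn => // _; apply: eq_ess_sup.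
  by apply: filterS fg => x /= /(_ I) ->.
Qed.

(* [LspaceType] quotients {mfun T >-> measurableTypeR R} whereas [LfunType] is
   built on {mfun T >-> R}; both carry the Borel sigma-algebra. *)
Let to_mfunR (f : {mfun T >-> R}) : {mfun T >-> measurableTypeR R} :=
  @MeasurableFun.Pack _ _ T (measurableTypeR R) f
    (MeasurableFun.Class
      (isMeasurableFun.Build _ _ T (measurableTypeR R) f (measurable_funPT f))).

Let of_mfunR (f : {mfun T >-> measurableTypeR R}) : {mfun T >-> R} :=
  @MeasurableFun.Pack _ _ T R f
    (MeasurableFun.Class
      (isMeasurableFun.Build _ _ T R f (measurable_funPT f))).

Lemma ae_repr (f : {mfun T >-> R}) :
  ((\pi_M (to_mfunR f) : M) : T -> R) = f %[ae mu].
Proof.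
have /eqmodP/asboolP := reprK (\pi_M (to_mfunR f) : M).
exact.
Qed.

Lemma Lclass_finite (f : Lf) : finite_norm mu p (\pi_M (to_mfunR f) : M).
Proof.
rewrite /finite_norm (@ae_eq_Lnorm (of_mfunR (repr (\pi_M (to_mfunR f)))) f)//;
  last exact: ae_repr.
exact: Lfunction_finite.
Qed.

Definition Lclass (f : Lf) : Lp :=
  LebesgueSpace.Pack (LebesgueSpace.Class
    (isFinLebesgue.Build d T R mu p p1 _ (Lclass_finite f))).

Definition Lrep_mfun (u : Lp) : {mfun T >-> R} := of_mfunR (repr (u : M)).

Lemma Lrep_subproof (u : Lp) : (Lrep_mfun u : T -> R) \in Lfun mu p.
Proof.
apply/andP; split; rewrite inE /=; first exact: (measurable_funPT (Lrep_mfun u)).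
exact: Lebesgue_finite.
Qed.

Definition Lrep (u : Lp) : Lf := Lfun_Sub p1 (Lrep_subproof u).

Lemma Lspace_eq (u v : Lp) : u = v :> M -> u = v.
Proof.
case: u v => [u [[hu]]] [v [[hv]]] /= uv.
move: hv; rewrite -uv => hv.
by rewrite (Prop_irrelevance hu hv).
Qed.

Lemma LrepK (u : Lp) : Lclass (Lrep u) = u.
Proof.
apply: Lspace_eq => /=; rewrite -[RHS]reprK; congr (\pi_M _).
exact/val_inj.
Qed.

Lemma LclassP (f g : Lf) : Lclass f = Lclass g <-> f = g %[ae mu].
Proof.
split.
  move=> /(congr1 (fun u : Lp => u : M)) /= /eqmodP/asboolP; exact.
by move=> fg; apply: Lspace_eq => /=; apply/eqmodP/asboolP.
Qed.

Lemma LclassK (f : Lf) : Lclass f = f %[ae mu].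
Proof. exact: ae_repr. Qed.


Lemma Lspace_ext (u v : Lp) : (u : T -> R) = v %[ae mu] -> u = v.
Proof. by move=> uv; rewrite -(LrepK u) -(LrepK v); apply/LclassP. Qed.

HB.instance Definition _ := gen_eqMixin Lp.
HB.instance Definition _ := gen_choiceMixin Lp.

Definition Lspace_zero : Lp := Lclass 0.
Definition Lspace_opp (u : Lp) : Lp := Lclass (- Lrep u).
Definition Lspace_add (u v : Lp) : Lp := Lclass (Lrep u + Lrep v).
Definition Lspace_scale (a : R) (u : Lp) : Lp := Lclass (a *: Lrep u).

Lemma Lclass_opp f : Lspace_opp (Lclass f) = Lclass (- f).
Proof.
apply/LclassP; apply: filterS (LclassK f) => x /(_ I) fx _.
exact: (congr1 (fun y : R => - y) fx).
Qed.

Lemma Lclass_add f g : Lspace_add (Lclass f) (Lclass g) = Lclass (f + g).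
Proof.
apply/LclassP; apply: filterS2 (LclassK f) (LclassK g) => x fx gx _.
exact: (congr2 (fun y z : R => y + z) (fx I) (gx I)).
Qed.

Lemma Lclass_scale a f : Lspace_scale a (Lclass f) = Lclass (a *: f).
Proof.
apply/LclassP; apply: filterS (LclassK f) => x /(_ I) fx _.
exact: (congr1 (fun y : R => a * y) fx).
Qed.

Lemma Lclass_ind (P : Lp -> Prop) :
  (forall f, P (Lclass f)) -> forall u, P u.
Proof. by move=> Pf u; rewrite -(LrepK u). Qed.

Let addA : associative Lspace_add.
Proof.
elim/Lclass_ind => f; elim/Lclass_ind => g; elim/Lclass_ind => h.
by rewrite !Lclass_add addrA.
Qed.

Let addC : commutative Lspace_add.
Proof.
by elim/Lclass_ind => f; elim/Lclass_ind => g; rewrite !Lclass_add addrC.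
Qed.

Let add0 : left_id Lspace_zero Lspace_add.
Proof. by elim/Lclass_ind => f; rewrite Lclass_add add0r. Qed.

Let addN : left_inverse Lspace_zero Lspace_opp Lspace_add.
Proof. by elim/Lclass_ind => f; rewrite Lclass_opp Lclass_add addNr. Qed.

HB.instance Definition _ := GRing.isZmodule.Build Lp addA addC add0 addN.

Lemma LclassD f g : Lclass f + Lclass g = Lclass (f + g).
Proof. exact: Lclass_add. Qed.

Let scaleA a b u : Lspace_scale a (Lspace_scale b u) = Lspace_scale (a * b) u.
Proof. by elim/Lclass_ind: u => f; rewrite !Lclass_scale scalerA. Qed.

Let scale1 : left_id 1 Lspace_scale.
Proof. by elim/Lclass_ind => f; rewrite Lclass_scale scale1r. Qed.

Let scaleDr : right_distributive Lspace_scale +%R.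
Proof.
move=> a; elim/Lclass_ind => f; elim/Lclass_ind => g.
by rewrite LclassD !Lclass_scale LclassD scalerDr.
Qed.

Let scaleDl u : {morph Lspace_scale^~ u : a b / a + b}.
Proof.
move=> a b; elim/Lclass_ind: u => f.
by rewrite /= !Lclass_scale LclassD scalerDl.
Qed.

HB.instance Definition _ :=
  GRing.Zmodule_isLmodule.Build R Lp scaleA scale1 scaleDr scaleDl.

Definition Lspace_norm (u : Lp) : R := fine ('N[mu]_p[EFin \o u])%E.

Lemma Lspace_norm_class f :
  Lspace_norm (Lclass f) = fine ('N[mu]_p[EFin \o f])%E.
Proof. congr fine; exact: (@ae_eq_Lnorm (Lrep (Lclass f)) f (LclassK f)). Qed.

Let ler_normD u v : Lspace_norm (u + v) <= Lspace_norm u + Lspace_norm v.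
Proof.
elim/Lclass_ind: u => f; elim/Lclass_ind: v => g.
rewrite LclassD !Lspace_norm_class.
exact: ler_LnormD.
Qed.

Let normZ (a : R) u : Lspace_norm (a *: u) = `|a| * Lspace_norm u.
Proof.
elim/Lclass_ind: u => f.
rewrite -[_ *: _]/(Lspace_scale _ _) Lclass_scale !Lspace_norm_class.
by rewrite [in LHS]LnormZ -finite_norm_fine.
Qed.

Let norm0_eq0 u : Lspace_norm u = 0 -> u = 0.
Proof.
elim/Lclass_ind: u => f; rewrite Lspace_norm_class => /fine_Lnormr_eq0 f0.
exact/LclassP.
Qed.

HB.instance Definition _ :=
  Lmodule_isNormed.Build R Lp ler_normD normZ norm0_eq0.

Lemma Lspace_normE (u : Lp) : `|u| = fine ('N[mu]_p[EFin \o u])%E.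
Proof. by []. Qed.

End Lspace_normed.

Section operators.
Context (R : realType) (X : normedModType R).
Implicit Type S : X -> X.

Definition bounded_operator S : Prop :=
  exists C : R, forall u : X, `|S u| <= C * `|u|.

Definition topologically_transitive S : Prop :=
  forall U V : set X, open U -> open V -> U !=set0 -> V !=set0 ->
    exists k : nat, (iter k S @` U) `&` V !=set0.

Definition topologically_mixing S : Prop :=
  forall U V : set X, open U -> open V -> U !=set0 -> V !=set0 ->
    exists k0 : nat, forall k : nat, (k0 <= k)%N ->
      (iter k S @` U) `&` V !=set0.

End operators.

Definition bimeasurable d d' (T : measurableType d) (T' : measurableType d')
    (f : T -> T') : Prop :=
  (forall B, measurable B -> measurable (f @^-1` B)) /\
  (forall A, measurable A -> measurable (f @` A)).

(* S is the operator phi |-> phi \o s on L^p(mu): the class S u is that of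
   f \o s for every measurable representative f of the class u. In particular,
   phi |-> phi \o s is well defined on classes and maps L^p(mu) to itself. *)
Definition is_composition_operator d (T : measurableType d) (R : realType)
    (mu : {measure set T -> \bar R}) (p : \bar R) (p1 : (1 <= p)%E)
    (s : T -> T) (S : LspaceType mu p1 -> LspaceType mu p1) : Prop :=
  forall (u : LspaceType mu p1) (f : {mfun T >-> R}),
    (u : T -> R) = f %[ae mu] -> (S u : T -> R) = f \o s %[ae mu].

Definition natpos : Type := {n : nat | (0 < n)%N}.

HB.instance Definition _ := Choice.on natpos.
HB.instance Definition _ := isPointed.Build natpos (exist _ 1%N (ltn0Sn 0)).
HB.instance Definition _ := @isMeasurable.Build default_measure_display
  natpos discrete_measurable discrete_measurable0
  discrete_measurableC discrete_measurableU.

Definition sigma (i : natpos) : natpos := exist _ (sval i).+1 (ltn0Sn (sval i)).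

(* Main.v *)
(** The measure gives the point [n + 1] the weight [w n = 2^-(a n)], where
    [a] is the sequence 0, 0 1, 0 1 2, 0 1 2 3, ...  All weights are positive,
    so classes of functions are plain sequences and the operator is the
    backward shift; it is bounded since [w n <= 2 w (n + 1)].

    Arbitrarily long windows of arbitrarily small weights occur arbitrarily far.
    Hence if [u] and [v] have finite support, translating [v] into a window
    starting at [k] gives a vector [s] of small norm with [T^k (u + s) = v]:
    this is transitivity. But
    [w k = 1] for infinitely many [k], and then [T^k] cannot send a vector of
    norm < 1/2 to one whose first coordinate exceeds 1/2: [T] is not mixing.
    Finally, each [k >= 1] is the distance of two consecutive zeros of [a], so
    two points of measure 1 at distance [k] both lie in any [B] whose complement
    has measure < 1. *)
From HB Require Import structures.
Require Import Defs.
From mathcomp Require Import all_boot all_order all_algebra.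
From mathcomp Require Import all_classical all_reals all_analysis.
Import Order.TTheory GRing.Theory Num.Theory.
Import numFieldNormedType.Exports.
Local Open Scope classical_set_scope.
Local Open Scope ring_scope.

Definition pos (n : nat) : natpos := exist _ n.+1 (ltn0Sn n).

Definition idx (x : natpos) : nat := (sval x).-1.

Lemma idxK : cancel idx pos.
Proof. by move=> [[|n] //= n0]; exact/val_inj. Qed.

Lemma sigma_inj : injective sigma.
Proof. by move=> x y [] xy; exact/val_inj. Qed.

Lemma iter_sigma_pos k n : iter k sigma (pos n) = pos (n + k).
Proof. by elim: k => [|k ih] /=; rewrite ?addn0// ih addnS. Qed.

(** * Measures given by positive weights *)

Section weighted_measure.
Context {R : realType} (w : nat -> R) (w_gt0 : forall n, 0 < w n).
Local Open Scope ereal_scope.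

Definition wmeasure : {measure set natpos -> \bar R} :=
  mseries (fun n => mscale (NngNum (ltW (w_gt0 n))) (dirac (pos n))) 0.

Lemma wmeasure_integral (f : natpos -> \bar R) : (forall x, 0 <= f x) ->
  \int[wmeasure]_x f x = \sum_(0 <= n <oo) (w n)%:E * f (pos n).
Proof.
move=> f0; rewrite ge0_integral_measure_series//.
apply: eq_eseriesr => n _.
rewrite ge0_integral_mscale// integral_dirac//.
by rewrite diracE in_setT mul1e.
Qed.

Lemma wmeasure_ge n (A : set natpos) : A (pos n) -> (w n)%:E <= wmeasure A.
Proof.
move=> An; have := nneseries_lim_ge (m:=0) (P:=xpredT) n.+1
  (u_ := fun n => mscale (NngNum (ltW (w_gt0 n))) (dirac (pos n)) A).
move=> h; apply: le_trans (h _) => //; rewrite big_mkord big_ord_recr/=.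
by rewrite {2}/mscale/= diracE mem_set// mule1 leeDr// sume_ge0.
Qed.

Lemma wmeasure_set1 n : wmeasure [set pos n] = (w n)%:E.
Proof.
rewrite /wmeasure/= /mseries (@nneseriesD1 _ _ n)//=.
rewrite {1}/mscale/= diracE mem_set// mule1 eseries0 ?adde0// => k _ kn.
rewrite /mscale/= diracE memNset ?mule0// => /(congr1 idx) /= /eqP.
exact/negP.
Qed.

Lemma sigma_finite_wmeasure : sigma_finite setT wmeasure.
Proof.
exists (fun n => [set pos n]).
  by apply/esym/seteqP; split=> // x _; exists (idx x) => //=; rewrite idxK.
by move=> n; split=> //; rewrite [ltLHS]wmeasure_set1 ltry.
Qed.

(** Every point has positive mass, so the empty set is the only null set. *)
Lemma ae_wmeasure (P : natpos -> Prop) :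
  (\forall x \ae wmeasure, P x) <-> forall x, P x.
Proof.
split=> [[N [_ N0 PN]] x|Px]; last exact/nearW.
apply: contrapT => /(PN x); rewrite -(idxK x) => /wmeasure_ge.
by rewrite N0 lee_fin leNgt w_gt0.
Qed.

End weighted_measure.

(** * The weighted sequence space in coordinates *)

Section weighted_Lspace.
Context {R : realType} {w : nat -> R} {w_gt0 : forall n, 0 < w n}.
Context {p : R} {p1 : (1 <= p%:E)%E}.
Local Notation mu := (wmeasure w w_gt0).
Local Notation Lp := (LspaceType mu p1).
Implicit Types (u v : Lp) (f : nat -> R).

Let p_gt0 : 0 < p. Proof. by apply: lt_le_trans ltr01 _; rewrite -lee_fin. Qed.
Let p_neq0 : p != 0. Proof. exact: lt0r_neq0. Qed.

Definition coords u (n : nat) : R := u (pos n).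

(** The p-th power of the weighted l^p norm, extended-real so that finiteness expresses membership
    in the space. *)
Definition wsum f : \bar R := (\sum_(0 <= n <oo) (w n * `|f n| `^ p)%:E)%E.

Lemma wterm_ge0 f n : (0 <= (w n * `|f n| `^ p)%:E)%E.
Proof. by rewrite lee_fin mulr_ge0 ?powR_ge0// ltW. Qed.

Lemma wsum_finite f N : (forall n, (N <= n)%N -> f n = 0) ->
  wsum f = (\sum_(n < N) w n * `|f n| `^ p)%:E.
Proof.
move=> fN; rewrite /wsum (nneseries_split 0 N); last first.
  by move=> n _; exact: wterm_ge0.
rewrite add0n [X in (_ + X)%E]eseries0 ?adde0; last first.
  by move=> n Nn _; rewrite fN// normr0 powR0// mulr0.
by rewrite big_mkord sumEFin.
Qed.

Lemma le_wsum f g : (forall n, `|f n| <= `|g n|) -> (wsum f <= wsum g)%E.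
Proof.
move=> fg; apply: lee_nneseries => [n _ _|n _]; first exact: wterm_ge0.
by rewrite lee_fin (ler_wpM2l (ltW (w_gt0 n)))// ge0_ler_powR// ?nnegrE// ltW.
Qed.

Lemma norm_Lspace_wsum u : (`|u| `^ p)%:E = wsum (coords u).
Proof.
have NE : `|u|%:E = ('N[mu]_p%:E[EFin \o u])%E := finite_norm_fine (Lrep u).
rewrite -poweR_EFin NE poweR_Lnorm//.
rewrite wmeasure_integral; last by move=> x; exact: poweR_ge0.
by apply: eq_eseriesr => n _; rewrite EFinM.
Qed.

Lemma wsum_coords_lty u : (wsum (coords u) < +oo)%E.
Proof. by rewrite -norm_Lspace_wsum ltry. Qed.

Lemma norm_Lspace_lt u (r : R) : 0 < r ->
  (wsum (coords u) < (r `^ p)%:E)%E -> `|u| < r.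
Proof.
move=> r0; rewrite -norm_Lspace_wsum lte_fin; apply: contraTT.
rewrite -!leNgt => ru.
by rewrite ge0_ler_powR// ?nnegrE// ltW.
Qed.

Lemma Lspace_of_coords f : (wsum f < +oo)%E -> exists u, coords u =1 f.
Proof.
move=> foo; have fP : (f \o idx) \in Lfun mu p%:E.
  apply/andP; split; rewrite inE//= /finite_norm unlock /=.
  apply: poweR_lty.
  rewrite wmeasure_integral; last by move=> x; rewrite lee_fin powR_ge0.
  rewrite [ltLHS](_ : _ = wsum f)//.
exists (Lclass (Lfun_Sub p1 fP)) => n.
by have /ae_wmeasure/(_ (pos n) I) := LclassK (Lfun_Sub p1 fP).
Qed.

Lemma coords_inj u v : coords u =1 coords v -> u = v.
Proof.
move=> uv; apply/Lspace_ext/ae_wmeasure => x _.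
by rewrite -(idxK x); exact: uv.
Qed.

Lemma coordsD u v n : coords (u + v) n = coords u n + coords v n.
Proof. by have /ae_wmeasure/(_ (pos n) I) := LclassK (Lrep u + Lrep v). Qed.

Lemma coordsZ (a : R) u n : coords (a *: u) n = a * coords u n.
Proof. by have /ae_wmeasure/(_ (pos n) I) := LclassK (a *: Lrep u). Qed.

Lemma coordsB u v n : coords (u - v) n = coords u n - coords v n.
Proof. by rewrite -scaleN1r coordsD coordsZ mulN1r. Qed.

Lemma coords_le_norm u n : 1 <= w n -> `|coords u n| <= `|u|.
Proof.
move=> wn; have un : `|coords u n| `^ p <= `|u| `^ p.
  rewrite -lee_fin norm_Lspace_wsum.
  apply: le_trans (nneseries_lim_ge n.+1 _); last first.
    by move=> k _ _; exact: wterm_ge0.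
  rewrite sumEFin lee_fin big_mkord big_ord_recr/= ler_wpDl//.
    by rewrite sumr_ge0// => k _; rewrite -lee_fin wterm_ge0.
  by rewrite ler_peMl// powR_ge0.
by rewrite leNgt; apply: contraTN un => uu; rewrite -ltNge gt0_ltr_powR ?nnegrE.
Qed.

(** Truncate [u]: the p-th power of the error is a tail of a convergent series. *)
Lemma finitely_supported_dense u (e : R) : 0 < e ->
  exists N v, (forall n, (N <= n)%N -> coords v n = 0) /\ `|u - v| < e.
Proof.
move=> e0; have ep0 : 0 < e `^ p by exact: powR_gt0.
have : (\forall N \near \oo,
    (\sum_(N <= n <oo) (w n * `|coords u n| `^ p)%:E)%E < (e `^ p)%:E)%E.
  have tail0 := nneseries_tail_cvg (wsum_coords_lty u) (fun k _ => wterm_ge0 _ k).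
  apply: (tail0 [set x | (x < (e `^ p)%:E)%E]).
  by apply: open_ereal_lt'; rewrite lte_fin.
move=> [N _ /(_ N (leqnn N)) /= tailN].
have [|v vE] := @Lspace_of_coords (fun n => if (n < N)%N then coords u n else 0).
  apply: le_lt_trans (wsum_coords_lty u); apply: le_wsum => n.
  by case: ifP => //; rewrite normr0.
exists N, v; split=> [n Nn|]; first by rewrite vE ltnNge Nn.
apply: (norm_Lspace_lt _ _ e0).
rewrite /wsum (nneseries_split 0 N); last by move=> k _; exact: wterm_ge0.
rewrite add0n big_nat big1 ?add0e; last first.
  by move=> n /andP[_ nN]; rewrite coordsB vE nN subrr normr0 powR0// mulr0.
apply: le_lt_trans tailN; apply: lee_nneseries => [n _ _|n _].
  exact: wterm_ge0.
have [nN|Nn] := ltnP n N; last by rewrite coordsB vE ltnNge Nn subr0.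
rewrite coordsB vE nN subrr normr0 powR0// mulr0; exact: wterm_ge0.
Qed.

Lemma open_ball_Lspace (U : set Lp) u : open U -> U u ->
  exists2 e : R, 0 < e & forall v, `|u - v| < e -> U v.
Proof.
move=> oU Uu; have /nbhs_ballP[e /= e0 eU] := open_nbhs_nbhs (conj oU Uu).
by exists e => // v uv; apply: eU; rewrite -ball_normE.
Qed.


(** * The backward shift *)

Context (C : R) (wC : forall n, w n <= C * w n.+1).

Let C_gt0 : 0 < C.
Proof. by rewrite -(pmulr_lgt0 C (w_gt0 1)) (lt_le_trans (w_gt0 0)). Qed.

(** Termwise, [wC] bounds the left side by [C] times the series of [f] without its first term. *)
Lemma wsum_shift f : (wsum (fun n => f n.+1) <= C%:E * wsum f)%E.
Proof.
rewrite -nneseriesZl => [|n _]; last exact: wterm_ge0.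
rewrite nneseries_recl//; last first.
  by move=> n _; rewrite mule_ge0 ?wterm_ge0// lee_fin ltW.
rewrite -[leLHS]add0e leeD//.
  by rewrite mule_ge0 ?wterm_ge0// lee_fin ltW.
rewrite -(nneseries_addn 1); last first.
  by move=> n; rewrite mule_ge0 ?wterm_ge0// lee_fin ltW.
apply: lee_nneseries => [n _ _|n _].
  by rewrite lee_fin mulr_ge0 ?powR_ge0// ltW.
by rewrite -EFinM lee_fin addn1 mulrA ler_wpM2r// powR_ge0.
Qed.

Lemma shift_subproof u : exists v, coords v =1 (fun n => coords u n.+1).
Proof.
apply: Lspace_of_coords; apply: le_lt_trans (wsum_shift _) _.
by rewrite -norm_Lspace_wsum -EFinM ltry.
Qed.

Definition shift u : Lp := sval (cid (shift_subproof u)).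

Lemma coords_shift u n : coords (shift u) n = coords u n.+1.
Proof. by rewrite /shift; case: cid. Qed.

Lemma coords_iter_shift k u n : coords (iter k shift u) n = coords u (n + k).
Proof. by elim: k n => [|k ih] n; rewrite ?addn0//= coords_shift ih addnS. Qed.

Lemma shift_linear : linear shift.
Proof.
by move=> a u v; apply: coords_inj => n; rewrite !(coords_shift, coordsD, coordsZ).
Qed.

HB.instance Definition _ := GRing.isLinear.Build R Lp Lp *:%R shift shift_linear.

Lemma shift_composition : is_composition_operator sigma shift.
Proof.
move=> u f /ae_wmeasure uf; apply/ae_wmeasure => x _.
by rewrite -(idxK x) [LHS]coords_shift [LHS]uf.
Qed.

Lemma shift_bounded : bounded_operator shift.
Proof.
exists (C `^ p^-1) => u; rewrite leNgt; apply/negP => ltu.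
have : (wsum (coords (shift u)) <= C%:E * wsum (coords u))%E.
  rewrite (_ : coords (shift u) = fun n => coords u n.+1); last first.
    by apply/funext => n; exact: coords_shift.
  exact: wsum_shift.
rewrite -!norm_Lspace_wsum -EFinM lee_fin leNgt => /negP; apply.
(* Write [C] as the p-th power of its p-th root, so that strict monotonicity of the power applies to
   [ltu]. *)
rewrite -[X in X * _](powRr1 (ltW C_gt0)) -(mulVf p_neq0) powRrM.
rewrite -powRM ?powR_ge0// gt0_ltr_powR// ?nnegrE//.
by rewrite mulr_ge0 ?powR_ge0.
Qed.

Lemma shift_transitive :
  (forall N (e : R), 0 < e -> exists2 k, (N <= k)%N &
     forall j, (j < N)%N -> w (k + j) <= e) ->
  topologically_transitive shift.
Proof.
move=> small U V oU oV [u Uu] [v Vv].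
have [e e0 Ue] := open_ball_Lspace _ _ oU Uu.
have [d d0 Vd] := open_ball_Lspace _ _ oV Vv.
have [N1 [u' [u'0 uu']]] := finitely_supported_dense u _ e0.
have [N2 [v' [v'0 vv']]] := finitely_supported_dense v _ d0.
pose N := maxn N1 N2; pose A := \sum_(j < N) `|coords v' j| `^ p.
have A0 : 0 <= A by apply: sumr_ge0 => j _; exact: powR_ge0.
(* The room left around [u']: adding a vector of norm below [r] stays within [e] of [u]. *)
pose r := e - `|u - u'|; have r0 : 0 < r by rewrite subr_gt0.
have rp0 : 0 < r `^ p by exact: powR_gt0.
(* With this threshold [wsum f] is at most [r ^ p * A / (A + 1)], which is below [r ^ p]; the [+ 1]
   covers [A = 0]. *)
have [|k Nk wk] := small N (r `^ p / (A + 1)).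
  by rewrite divr_gt0// ltr_wpDl.
(* [v'] moved forward by [k], into the window of small weights. *)
pose f n := if (k <= n)%N then coords v' (n - k) else 0.
have f0 n : (k + N <= n)%N -> f n = 0.
  move=> kn; rewrite /f v'0 ?if_same// leq_subRL.
    by rewrite (leq_trans _ kn)// leq_add2l leq_maxr.
  by rewrite (leq_trans _ kn)// leq_addr.
have wf : (wsum f < (r `^ p)%:E)%E.
  rewrite (wsum_finite _ _ f0) lte_fin big_split_ord/= big1 ?add0r; last first.
    by move=> j _; rewrite /f leqNgt ltn_ord normr0 powR0// mulr0.
  apply: (@le_lt_trans _ _ (r `^ p / (A + 1) * A)).
    rewrite /A mulr_sumr ler_sum// => j _; rewrite /f leq_addr addKn.
    by rewrite ler_wpM2r ?powR_ge0// wk.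
  by rewrite -mulrA gtr_pMr// mulrC ltr_pdivrMr ?ltr_wpDl// mul1r ltrDl.
have [|s sE] := @Lspace_of_coords f; first by rewrite (lt_trans wf)// ltry.
exists k, v'; split; last exact: Vd.
exists (u' + s).
  apply: Ue; rewrite opprD addrA (le_lt_trans (ler_normB _ _))//.
  rewrite -ltrBrDl; apply: (norm_Lspace_lt _ _ r0).
  by rewrite (_ : coords s = f)//; exact/funext.
(* Since [k] is at least [N1], the shift erases [u'], and it brings [s] back to [v']. *)
apply: coords_inj => n; rewrite coords_iter_shift coordsD sE /f leq_addl addnK.
rewrite u'0 ?add0r// (leq_trans _ (leq_addl _ _))// (leq_trans _ Nk)//.
exact: leq_maxl.
Qed.

Lemma shift_not_mixing : 1 <= w 0 ->
  (forall k0, exists2 k, (k0 <= k)%N & 1 <= w k) ->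
  ~ topologically_mixing shift.
Proof.
move=> w0 large mix.
(* The first basis vector; mixing is tested on the balls of radius 1/2 around 0 and [e]. *)
have [|e eE] := @Lspace_of_coords (fun n => (n == 0)%:R).
  by rewrite (wsum_finite _ 1) ?ltry// => -[].
have half0 : 0 < 2^-1 :> R by rewrite invr_gt0.
have [k0 k0mix] := mix _ _ (ball_open (0 : Lp) 2^-1) (ball_open e 2^-1)
  (ex_intro _ _ (ballxx _ half0)) (ex_intro _ _ (ballxx _ half0)).
have [k k0k wk] := large k0.
have [_ [[u u0 <-]]] := k0mix k k0k.
move: u0; rewrite -!ball_normE/= sub0r normrN => u0 eu.
(* Coordinate 0 of [e - T^k u] is [1 - u_k], of modulus below 1/2; but [wk] gives that [u_k] has
   modulus below 1/2 too. *)
have := le_lt_trans (coords_le_norm _ _ w0) eu.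
rewrite coordsB eE coords_iter_shift add0n ltNge => /negP; apply.
apply: le_trans (lerB_dist _ _); rewrite normr1.
have := le_lt_trans (coords_le_norm _ _ wk) u0.
by move=> /ltW uk; rewrite lerBrDl [leRHS](splitr 1) div1r lerD.
Qed.

End weighted_Lspace.

(** A state pairs the current value with the top of the current run; past the top, a run one longer
    starts. *)
Definition sawtooth_step (s : nat * nat) : nat * nat :=
  if (s.1 < s.2)%N then (s.1.+1, s.2) else (0%N, s.2.+1).

(* The sequence 0, 0 1, 0 1 2, 0 1 2 3, ... *)
Definition sawtooth (i : nat) : nat := (iter i sawtooth_step (0%N, 0%N)).1.

Lemma sawtoothS i : (sawtooth i.+1 <= (sawtooth i).+1)%N.
Proof. by rewrite /sawtooth/= {1}/sawtooth_step; case: ifP. Qed.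

Lemma iter_sawtooth_step n j : (j <= n)%N ->
  iter j sawtooth_step (0%N, n) = (j, n).
Proof. by elim: j => //= j ih jn; rewrite ih 1?ltnW// /sawtooth_step/= jn. Qed.

Lemma sawtooth_period n : exists i, [/\ (n <= i)%N,
  forall j, (j <= n)%N -> sawtooth (i + j) = j & sawtooth (i + n.+1) = 0%N].
Proof.
have start : exists2 i, (n <= i)%N & iter i sawtooth_step (0%N, 0%N) = (0%N, n).
  elim: n => [|n [i ni iE]]; first by exists 0%N.
  (* The run with top [n] has [n.+1] terms. *)
  exists (n.+1 + i)%N; first exact: leq_addr.
  by rewrite iterD iE /= iter_sawtooth_step// /sawtooth_step ltnn.
have [i ni iE] := start; exists i; split=> // [j jn|].
  by rewrite /sawtooth addnC iterD iE iter_sawtooth_step.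
by rewrite /sawtooth addnC iterD iE/= iter_sawtooth_step// /sawtooth_step ltnn.
Qed.

(** * The weights *)

Section sawtooth_weight.
Context (R : realType).

Definition weight (n : nat) : R := 2^-1 ^+ sawtooth n.

Lemma weight_gt0 n : 0 < weight n.
Proof. by rewrite exprn_gt0// invr_gt0. Qed.

(** The sawtooth rises by at most 1 per step, so the weight at most halves. *)
Lemma weight_ratio n : weight n <= 2 * weight n.+1.
Proof.
have : 2 * 2^-1 ^+ (sawtooth n).+1 <= 2 * weight n.+1.
  rewrite ler_pM2l// ler_wiXn2l ?invr_ge0 ?invf_le1 ?ler1n//.
  exact: sawtoothS.
by rewrite exprS mulrA divff ?mul1r.
Qed.

Lemma weight_small N (e : R) : 0 < e -> exists2 k, (N <= k)%N &
  forall j, (j < N)%N -> weight (k + j) <= e.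
Proof.
move=> e0; have [M _ /(_ M (leqnn M)) /= Me] :=
  near_infty_natSinv_expn_lt (PosNum e0).
(* In the run with top [M + N], skip the first [M] terms: the next [N] values are at least [M], and
   [2 ^- M] is below [e]. *)
have [i [ni run _]] := sawtooth_period (M + N).
exists (i + M)%N => [|j jN].
  by rewrite (leq_trans _ (leq_addr _ _))// (leq_trans _ ni)// leq_addl.
rewrite /weight -addnA run; last by rewrite leq_add2l ltnW.
apply: le_trans (ltW Me); rewrite div1r -exprVn.
by rewrite ler_wiXn2l ?invr_ge0 ?invf_le1 ?ler1n// leq_addr.
Qed.

(** The zeros starting a run with top [n] and the run after it. *)
Lemma weight_one n : exists i, [/\ (n <= i)%N, weight i = 1 & weight (i + n.+1) = 1].
Proof.
have [i [ni /(_ 0%N (leq0n _))]] := sawtooth_period n; rewrite addn0 => i0 iS.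
by exists i; rewrite /weight i0 iS.
Qed.

End sawtooth_weight.

Theorem corollary3p2 (R : realType) :
  exists mu : {measure set natpos -> \bar R},
    [/\ sigma_finite [set: natpos] mu,
        injective sigma,
        bimeasurable sigma,
        forall (p : R) (p1 : (1 <= p%:E)%E),
          exists T : {linear LspaceType mu p1 -> LspaceType mu p1},
            [/\ is_composition_operator sigma T,
                bounded_operator T,
                topologically_transitive T &
                ~ topologically_mixing T] &
        ~ (forall e : R, 0 < e ->
             exists (B : set natpos) (k : nat),
               [/\ measurable B,
                   (1 <= k)%N,
                   (mu (~` B) < e%:E)%E &
                   B `&` (iter k sigma @` B) = set0])].
Proof.
exists (wmeasure (weight R) (weight_gt0 R)); split.
- exact: sigma_finite_wmeasure.
- exact: sigma_inj.
- by [].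
- move=> p p1; exists (shift 2 (weight_ratio R)); split.
  + exact: shift_composition.
  + exact: shift_bounded.
  + exact/shift_transitive/weight_small.
  (* [weight 0] computes to 1, as the sawtooth starts at 0. *)
  + apply: shift_not_mixing => [|n]; first exact: lexx.
    by have [i [ni wi _]] := weight_one R n; exists i; rewrite ?wi.
- move=> /(_ 1 ltr01)[B [k [_ k_gt0 muB disj]]].
  case: k k_gt0 disj => // k _ disj.
  (* A point of mass 1 outside [B] would give the complement measure at least 1. *)
  have inB n : weight R n = 1 -> B (pos n).
    move=> wn; apply: contrapT => nB.
    have := wmeasure_ge _ (weight_gt0 R) n (~` B) nB.
    by rewrite wn leNgt muB.
  have [i [_ /inB Bi /inB Bik]] := weight_one R k.
  suff : set0 (pos (i + k.+1)) by [].
  by rewrite -disj; split=> //; exists (pos i) => //; rewrite iter_sigma_pos.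
Qed.
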